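(* Let $n \ge 2$, let $L$ be a finite-dimensional $n$-Lie algebra over a field $F$, and let $E = E_L(d)$ be an Engel subalgebra of $L$. If $U$ is a subalgebra of $L$ with $E \subseteq U$, then $\mathcal{N}_L(U) = U$.
   Context: An $n$-Lie algebra over a field $F$ is an $F$-vector space $L$ with a linear map $\Lambda^n L \to L$, $x_1\wedge\dots\wedge x_n \mapsto [x_1,\dots,x_n]$ (so the bracket is $n$-linear and alternating), satisfying the generalised Jacobi identity $$[[x_1,\dots,x_n],y_2,\dots,y_n]=\sum_{i=1}^n [x_1,\dots,[x_i,y_2,\dots,y_n],\dots,x_n].$$ A subalgebra is a subspace closed under the bracket. The normaliser of a subalgebra $U$ is $\mathcal{N}_L(U)=\{x\in L\mid [x,u_1,\dots,u_{n-1}]\in U\text{ for all }u_1,\dots,u_{n-1}\in U\}$. For $a_1,\dots,a_{n-1}\in L$, $D(a_1,\dots,a_{n-1}):L\to L$ is the derivation $x\mapsto[a_1,\dots,a_{n-1},x]$. Linear combinations of such maps are called inner derivations. For a subspace $A\subseteq L$, $D(A)$ is the span of all $D(a_1,\dots,a_{n-1})$ with all $a_i\in A$ (as linear maps on $L$). For a derivation $d$ of $L$, $E_L(d)=\{x\in L\mid d^rx=0\text{ for some }r\}$, which is a subalgebra. For an inner derivation $d$ of $L$, the subalgebra $E=E_L(d)$ is called an Engel subalgebra if $d\in D(E)$. *)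

(* Defs.v *)
From HB Require Import structures.
From mathcomp Require Import all_boot all_algebra.
From mathcomp Require Import boolp classical_sets.

Set Implicit Arguments.
Unset Strict Implicit.
Unset Printing Implicit Defensive.

Import GRing.Theory.
Local Open Scope ring_scope.
Local Open Scope classical_set_scope.

(* The m.+1-tuple with [x] in slot [i] and [u] filling the others in order:  *)
(* (x, u_1, .., u_m) for i = ord0, and (u_1, .., u_m, x) for i = ord_max.    *)
Definition insert (T : Type) (m : nat) (i : 'I_m.+1) (x : T)
    (u : {ffun 'I_m -> T}) : {ffun 'I_m.+1 -> T} :=
  [ffun j => if unlift i j is Some k then u k else x].

(* The arity n is m.+1, so that tuples of length n - 1 are indexed by 'I_m.  *)
Record nLie_bracket (m : nat) (F : fieldType) (L : vectType F) := NLieBracket {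
  bracket :> {ffun 'I_m.+1 -> L} -> L;
  bracket_linear : forall (i : 'I_m.+1) (u : {ffun 'I_m -> L}),
    linear (fun x : L => bracket (insert i x u));
  bracket_alternating : forall (x : {ffun 'I_m.+1 -> L}) (i j : 'I_m.+1),
    i != j -> x i = x j -> bracket x = 0;
  bracket_jacobi : forall (x : {ffun 'I_m.+1 -> L}) (y : {ffun 'I_m -> L}),
    bracket (insert ord0 (bracket x) y) =
    \sum_(i < m.+1)
      bracket [ffun j => if j == i then bracket (insert ord0 (x i) y) else x j]
}.

Section NLie.
Variables (m : nat) (F : fieldType) (L : vectType F) (br : nLie_bracket m L).
Implicit Types (U : {vspace L}) (A : set L) (d : 'End(L)).

Definition subalgebra U : Prop :=
  forall x : {ffun 'I_m.+1 -> L}, (forall i, x i \in U) -> br x \in U.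

Definition normaliser U : set L :=
  [set x | forall u : {ffun 'I_m -> L},
             (forall i, u i \in U) -> br (insert ord0 x u) \in U].

Definition D (a : {ffun 'I_m -> L}) : 'End(L) :=
  linfun (fun x => br (insert ord_max x a)).

Lemma DE (a : {ffun 'I_m -> L}) (x : L) : D a x = br (insert ord_max x a).
Proof.
pose f := GRing.isLinear.Build F L L *:%R _ (bracket_linear br ord_max a).
pose g : {linear L -> L} := HB.pack (fun z => br (insert ord_max z a)) f.
exact: (lfunE g x).
Qed.

(* The linear span, in 'End(L), of the D a with all a_i in A; it is written  *)
(* as a union of finite spans since A may be infinite.                       *)
Definition Dspan A : set 'End(L) :=
  [set d | exists2 s : seq {ffun 'I_m -> L},
             (forall a, a \in s -> forall i, A (a i)) &
             d \in <<[seq D a | a <- s]>>%VS].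

Definition inner_derivation d : Prop := Dspan setT d.

Definition Engel_space d : set L := [set x | exists r : nat, iter r d x = 0].

Definition Engel_subalgebra d : Prop :=
  inner_derivation d /\ Dspan (Engel_space d) d.

End NLie.

(* Main.v *)
Require Import Defs.
From mathcomp Require Import all_boot perm all_algebra.
From mathcomp Require Import boolp classical_sets.

(** Let x normalise U. Since d is a combination of maps D a with entries of a
    in E, hence in U, both d x and d @: U lie in U. The chain of the d^r @: U
    is decreasing, so it stabilises: d^r (d x) = d^(r+1) u for some u in U and
    some r. Then x - u is killed by d^(r+1), so x - u is in E, hence in U. *)

Set Implicit Arguments.
Unset Strict Implicit.
Unset Printing Implicit Defensive.

Import GRing.Theory.
Local Open Scope ring_scope.
Local Open Scope classical_set_scope.

(** [insert] wants the remaining entries as a shorter tuple; keeping the whole tuple makes it easy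
    to vary two slots at once. *)
Definition update (T : Type) (m : nat) (z : {ffun 'I_m.+1 -> T})
    (i : 'I_m.+1) (x : T) : {ffun 'I_m.+1 -> T} :=
  [ffun k => if k == i then x else z k].

Lemma update_insert (T : Type) (m : nat) (z : {ffun 'I_m.+1 -> T})
    (i : 'I_m.+1) (x : T) :
  update z i x = insert i x [ffun k => z (lift i k)].
Proof.
apply/ffunP => k; rewrite !ffunE.
case: unliftP => [j|] ->; first by rewrite eq_sym (negPf (neq_lift i j)) ffunE.
by rewrite eqxx.
Qed.

Lemma update_id (T : Type) (m : nat) (z : {ffun 'I_m.+1 -> T})
    (i : 'I_m.+1) : update z i (z i) = z.
Proof. by apply/ffunP => k; rewrite ffunE; case: eqP => [->|]. Qed.

Lemma updateC (T : Type) (m : nat) (z : {ffun 'I_m.+1 -> T})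
    (i j : 'I_m.+1) (x y : T) :
  i != j -> update (update z i x) j y = update (update z j y) i x.
Proof.
move=> ij; apply/ffunP => k; rewrite !ffunE.
by case: (eqVneq k j) => [->|//]; rewrite eq_sym (negPf ij).
Qed.

Section Bracket.
Variables (m : nat) (F : fieldType) (L : vectType F) (br : nLie_bracket m L).

Lemma bracket_updateD (z : {ffun 'I_m.+1 -> L}) (i : 'I_m.+1) (x y : L) :
  br (update z i (x + y)) = br (update z i x) + br (update z i y).
Proof.
rewrite !update_insert.
by have := bracket_linear br i [ffun k => z (lift i k)] 1 x y; rewrite !scale1r.
Qed.

(** Polarisation: with all slots but [i] and [j] frozen, the bracket is a biadditive form [f] that
    vanishes on the diagonal. Expanding [f (a + b) (a + b) = 0] leaves [f a b + f b a = 0], in any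
    characteristic. *)
Lemma bracket_tperm (z : {ffun 'I_m.+1 -> L}) (i j : 'I_m.+1) :
  i != j -> br [ffun k => z (tperm i j k)] = - br z.
Proof.
move=> ij; pose f x y := br (update (update z i x) j y).
have fDr x y y' : f x (y + y') = f x y + f x y' by exact: bracket_updateD.
have fDl x x' y : f (x + x') y = f x y + f x' y.
  by rewrite /f !(updateC _ _ _ ij) bracket_updateD.
have f0 x : f x x = 0.
  by apply: (bracket_alternating br ij); rewrite !ffunE !eqxx (negPf ij).
have -> : [ffun k => z (tperm i j k)] = update (update z i (z j)) j (z i).
  apply/ffunP => k; rewrite !ffunE.
  case: tpermP => [->|->|/eqP/negPf-> /eqP/negPf-> //].
    by rewrite (negPf ij) eqxx.
  by rewrite eqxx.
have -> : br z = f (z i) (z j).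
  by rewrite /f update_id update_id.
apply/eqP; rewrite -addr_eq0 -/(f (z j) (z i)).
by have := f0 (z i + z j); rewrite fDl !fDr !f0 add0r addr0 addrC => ->.
Qed.

(** The normaliser is defined through slot [ord0], whereas [D a] puts its argument in slot
    [ord_max]. A transposition only changes the sign of the bracket, so the slot is irrelevant for
    membership in [U]. *)
Lemma normaliser_bracket (U : {vspace L}) (z : {ffun 'I_m.+1 -> L})
    (i : 'I_m.+1) :
  normaliser br U (z i) -> (forall k, k != i -> z k \in U) -> br z \in U.
Proof.
have base (t : {ffun 'I_m.+1 -> L}) : normaliser br U (t ord0) ->
    (forall k, k != ord0 -> t k \in U) -> br t \in U.
  move=> nt0 tU; rewrite -(update_id t ord0) update_insert; apply: nt0 => k.
  by rewrite ffunE; apply: tU; rewrite eq_sym neq_lift.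
case: (eqVneq i ord0) => [->|i0]; first exact: base.
move=> nzi zU; rewrite -memvN -(bracket_tperm _ i0); apply: base.
  by rewrite ffunE tpermR.
move=> k k0; rewrite ffunE; apply: zU.
(* The transposition sends only [ord0] to [i], so every other slot of the permuted tuple holds an
   entry of [U]. *)
by rewrite -[X in _ != X](tpermR i ord0) (inj_eq perm_inj).
Qed.

Lemma sub_normaliser (U : {vspace L}) :
  subalgebra br U -> [set` U] `<=` normaliser br U.
Proof.
move=> subU x xU u uU; apply: subU => k; rewrite ffunE.
by case: unlift.
Qed.

Lemma Dspan_normaliser (A : set L) (U : {vspace L}) (d : 'End(L)) (x : L) :
  A `<=` [set` U] -> Dspan br A d -> normaliser br U x -> d x \in U.
Proof.
move=> AU [s sA ds] nx; rewrite (coord_span (X := in_tuple _) ds) sum_lfunE.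
apply: memv_suml => k _; rewrite scale_lfunE memvZ //=.
have /mapP[a /sA aA ->] := mem_nth 0 (ltn_ord k : (k < size _)%N).
rewrite DE; apply: (@normaliser_bracket _ _ ord_max).
  by rewrite ffunE unlift_none.
move=> j; rewrite ffunE; case: unliftP => [j' _ _|->]; last by rewrite eqxx.
exact/AU/aA.
Qed.

End Bracket.

Lemma iter_lfun_linear (F : fieldType) (L : vectType F) (d : 'End(L)) (r : nat) :
  linear (fun x => iter r d x).
Proof. by move=> a x y; elim: r => //= r ->; rewrite linearP. Qed.

(** Induction on [\dim U]: if [d] maps [U] onto itself, then [r = 0] works; otherwise pass to the
    strictly smaller [d @: U] and to [d y]. *)
Lemma stable_image_iter (F : fieldType) (L : vectType F) (d : 'End(L))
    (U : {vspace L}) (y : L) :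
  (d @: U <= U)%VS -> y \in U ->
  exists r, exists2 u, u \in U & iter r d y = iter r.+1 d u.
Proof.
have [n] := ubnP (\dim U); elim: n U y => // n IHn U y dimU dU yU.
case: (eqVneq (d @: U)%VS U) => [eU | neU].
  by exists 0%N; move: yU; rewrite -{1}eU => /memv_imgP[u uU ->]; exists u.
have ltdU : (\dim (d @: U) < n)%N.
  rewrite -ltnS (leq_trans _ dimU) // ltnS ltn_neqAle dimvS // andbT.
  by apply: contra neU => eqd; rewrite eqEdim dU (eqP eqd) leqnn.
(* The witness found in [d @: U] is [d u] with [u] in [U]; both sides thus carry one extra [d],
   which raises the exponent to [r.+1]. *)
have [r [_ /memv_imgP[u uU ->] e]] := IHn _ _ ltdU (limgS d dU) (memv_img d yU).
by exists r.+1, u => //; rewrite iterSr e -iterSr.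
Qed.

Theorem lemma3p3 (m : nat) (n_ge2 : (2 <= m.+1)%N) (F : fieldType)
    (L : vectType F) (br : nLie_bracket m L) (d : 'End(L))
    (engel_d : Engel_subalgebra br d) (U : {vspace L})
    (subU : subalgebra br U) (sEU : Engel_space d `<=` [set` U]) :
  normaliser br U = [set` U].
Proof.
case: engel_d => _ dE; apply/seteqP; split; last exact: sub_normaliser.
move=> x nx /=; have dU y : normaliser br U y -> d y \in U.
  exact: Dspan_normaliser sEU dE.
have stabU : (d @: U <= U)%VS.
  by apply/subvP => _ /memv_imgP[u uU ->]; apply/dU/sub_normaliser.
have [r [u uU e]] := stable_image_iter stabU (dU x nx).
rewrite -(subrK u x) memvD //; apply: sEU; exists r.+1.
(* Writing [x - u] as [-1 *: u + x] gives it the shape that [linear] expands. *)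
rewrite -[x - u]addrC -scaleN1r iter_lfun_linear scaleN1r.
by rewrite [X in _ + X]iterSr e addNr.
Qed.
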